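(* Let $\langle\cdot,\cdot\rangle$ denote the Fisher information metric on $\mathcal S$ based on a single observation $\bm{x}\sim N_p(\bm 0,\bm\Sigma)$. At every point $(\bm\lambda,\bm\Gamma)$ of $\mathcal S$, the components of this metric with respect to the spectral coordinates $(\bm\lambda,\bm u)$ are $$g_{ab}:=\langle\partial_a,\partial_b\rangle=\tfrac12\lambda_a^{-2}\,\delta(a=b),\qquad 1\le a,b\le p,$$ $$g_{a(s,t)}:=\langle\partial_a,\partial_{(s,t)}\rangle=0,\qquad 1\le a\le p,\ 1\le s<t\le p,$$ $$g_{(s,t)(u,v)}:=\langle\partial_{(s,t)},\partial_{(u,v)}\rangle=(\lambda_s-\lambda_t)^2\lambda_s^{-1}\lambda_t^{-1}\,\delta\bigl((s,t)=(u,v)\bigr),\qquad 1\le s<t\le p,\ 1\le u<v\le p.$$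
   Context: $\mathcal S$ is the family of $p$-variate normal distributions $N_p(\bm 0,\bm\Sigma)$ with $\bm\Sigma$ symmetric positive definite. It is viewed as a manifold identified with the set of such $\bm\Sigma=(\sigma_{ij})$. The eigenvalues of $\bm\Sigma$ are assumed distinct: $\lambda_1>\dots>\lambda_p>0$. Write $\bm\lambda=(\lambda_1,\dots,\lambda_p)$, and write $\bm\Sigma=\bm\Gamma\bm\Lambda\bm\Gamma^t$ with $\bm\Lambda=\mathrm{diag}(\bm\lambda)$ and $\bm\Gamma$ orthogonal. ''The point $(\bm\lambda,\bm\Gamma)$'' means $\bm\Sigma=\bm\Gamma\bm\Lambda\bm\Gamma^t$. Fisher information metric: for a parametric family of densities $f(\bm x;\bm\theta)$, its $(i,j)$ component with respect to $\bm\theta$ is $E_{\bm\theta}\bigl[\partial_{\theta_i}\log f(\bm x;\bm\theta)\,\partial_{\theta_j}\log f(\bm x;\bm\theta)\bigr]$. For $\mathcal S$, identifying tangent vectors at $\bm\Sigma$ (with respect to the coordinates $(\sigma_{ij})_{i\le j}$) with symmetric matrices $\bm A,\bm B$, it is $\frac12\mathrm{tr}(\bm\Sigma^{-1}\bm A\bm\Sigma^{-1}\bm B)$. Spectral coordinates: for $\bm u=(u_{ij})_{1\le i<j\le p}$, let $\bm U(\bm u)$ be the skew-symmetric matrix with $(\bm U)_{ij}=u_{ij}$ for $i<j$, $(\bm U)_{ij}=-u_{ji}$ for $i>j$, and $(\bm U)_{ii}=0$. Near a point with eigenvector matrix $\bm\Gamma$, the coordinates $(\bm\lambda,\bm u)$,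 with $\bm u$ near $\bm 0$, correspond to $$\bm\Sigma(\bm\lambda,\bm u)=\bm\Gamma\exp(\bm U(\bm u))\,\mathrm{diag}(\bm\lambda)\,\exp(\bm U(\bm u))^t\bm\Gamma^t .$$ The tangent vectors at $(\bm\lambda,\bm\Gamma)$ are $\partial_a=\partial/\partial\lambda_a$ and $\partial_{(s,t)}=\partial/\partial u_{st}$ for $s<t$, computed in the chart centred at $\bm\Gamma$ and evaluated at $\bm u=\bm 0$. $\delta(\cdot)$ equals $1$ if the condition in parentheses holds and $0$ otherwise. *)

(* Defs.v *)
From HB Require Import structures.
From mathcomp Require Import all_boot all_order all_algebra.
From mathcomp Require Import all_classical all_reals all_analysis.

Set Implicit Arguments.
Unset Strict Implicit.
Unset Printing Implicit Defensive.

Import Order.TTheory GRing.Theory Num.Theory.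
Import numFieldNormedType.Exports.

Local Open Scope classical_set_scope.
Local Open Scope ring_scope.

Section TupleCons.
Context d (T : measurableType d) (n : nat).

Definition tuple_cons (z : T * n.-tuple T) : n.+1.-tuple T :=
  [tuple of z.1 :: z.2].

Definition tuple_uncons (t : n.+1.-tuple T) : T * n.-tuple T :=
  (thead t, [tuple of behead t]).

Lemma measurable_tuple_cons : measurable_fun setT tuple_cons.
Proof. exact: measurable_cons. Qed.

Lemma measurable_tuple_uncons : measurable_fun setT tuple_uncons.
Proof.
apply/measurable_fun_pairP; split; first exact: measurable_tnth.
exact: measurable_behead.
Qed.

Lemma tuple_consK : cancel tuple_cons tuple_uncons.
Proof.
by case=> a t; rewrite /tuple_uncons theadE; congr (_, _); exact: val_inj.
Qed.

End TupleCons.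

Section TupleMeasureStep.
Context d (T : measurableType d) (R : realType).
Variable mu : {sigma_finite_measure set T -> \bar R}.
Variables (n : nat) (m : {sigma_finite_measure set (n.-tuple T) -> \bar R}).

Definition tuple_measure_step : set (n.+1.-tuple T) -> \bar R :=
  pushforward (mu \x m)%E (@tuple_cons _ T n).

Let mpreim (A : set (n.+1.-tuple T)) :
  measurable A -> measurable (@tuple_cons _ T n @^-1` A).
Proof.
by move=> mA; rewrite -[X in measurable X]setTI; exact: measurable_tuple_cons.
Qed.

Let step0 : tuple_measure_step set0 = 0%E.
Proof. by rewrite /tuple_measure_step /pushforward preimage_set0 measure0. Qed.

Let step_ge0 A : (0 <= tuple_measure_step A)%E.
Proof. exact: (measure_ge0 (mu \x m)%E). Qed.

Let step_sigma_additive : semi_sigma_additive tuple_measure_step.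
Proof.
move=> F mF tF mUF; rewrite /tuple_measure_step /pushforward preimage_bigcup.
apply: measure_semi_sigma_additive.
- by move=> k; exact: mpreim.
- apply/trivIsetP => /= i j _ _ ij; rewrite -preimage_setI.
  by move/trivIsetP : tF => /(_ _ _ _ _ ij) ->//; rewrite preimage_set0.
- by rewrite -preimage_bigcup; exact: mpreim.
Qed.

HB.instance Definition _ := isMeasure.Build _ _ _ tuple_measure_step
  step0 step_ge0 step_sigma_additive.

Let step_sigma_finite : sigma_finite setT tuple_measure_step.
Proof.
have /sigma_finiteP[F [TF ndF Foo]] := sigma_finiteT mu.
have /sigma_finiteP[G [TG ndG Goo]] := sigma_finiteT m.
exists (fun k => @tuple_uncons _ T n @^-1` (F k `*` G k)).
  rewrite -preimage_bigcup (_ : \bigcup_k _ = setT) ?preimage_setT//.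
  apply/seteqP; split => // -[x y] _.
  have [i _ Fx] : (\bigcup_k F k) x by rewrite -TF.
  have [j _ Gy] : (\bigcup_k G k) y by rewrite -TG.
  exists (maxn i j) => //; split => /=.
    by move: x Fx; exact/subsetPset/ndF/leq_maxl.
  by move: y Gy; exact/subsetPset/ndG/leq_maxr.
move=> k; have [mF Fk] := Foo k; have [mG Gk] := Goo k; split.
  rewrite -[X in measurable X]setTI; apply: measurable_tuple_uncons => //.
  exact: measurableX.
rewrite /tuple_measure_step /pushforward (_ : _ @^-1` _ = F k `*` G k).
  by rewrite product_measure1E// lte_mul_pinfty// ge0_fin_numE.
by apply/funext => z; rewrite /preimage/mkset tuple_consK.
Qed.

HB.instance Definition _ := Measure_isSigmaFinite.Build _ _ _
  tuple_measure_step step_sigma_finite.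

End TupleMeasureStep.

(* The n-fold product mu \x (mu \x (...)), carried by n.-tuple T; the recursion
   needs each stage to be sigma-finite for the next product to be a measure. *)
Fixpoint tuple_measure d (T : measurableType d) (R : realType)
    (mu : {sigma_finite_measure set T -> \bar R}) (n : nat) :
    {sigma_finite_measure set (n.-tuple T) -> \bar R} :=
  match n with
  | 0 => @dirac _ (0.-tuple T) [tuple] R
  | k.+1 => tuple_measure_step mu (tuple_measure mu k)
  end.

Definition lebesgue_tuple (R : realType) (n : nat) :
    {sigma_finite_measure set (n.-tuple (measurableTypeR R)) -> \bar R} :=
  tuple_measure (@lebesgue_measure R) n.

(* Density of N_p(0, Sigma) with respect to Lebesgue measure on R^p, meaningful
   for Sigma symmetric positive definite. *)
Definition normal0_pdf (R : realType) (p : nat) (Sigma : 'M[R]_p)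
    (x : p.-tuple (measurableTypeR R)) : R :=
  let v : 'cV[R]_p := \col_i tnth x i in
  (Num.sqrt ((2 * pi) ^+ p * \det Sigma))^-1 *
  expR (- (2^-1 * (v^T *m invmx Sigma *m v) 0 0)).

(* dfwith theta i h is theta with its i-th coordinate replaced by h, so this is
   the partial derivative of F at theta in the i-th coordinate. *)
Definition partial (R : realType) (I : eqType) (F : (I -> R) -> R)
    (theta : I -> R) (i : I) : R :=
  derive1 (fun h : R => F (dfwith theta i h)) (theta i).

(* E_theta[ d_i log f(x; theta) * d_j log f(x; theta) ], the expectation being
   taken under the density f theta with respect to mu. The integral is kept in
   \bar R: the junk value of a real-valued integral (0 when the integrand is not
   integrable) would be indistinguishable from a vanishing component. *)
Definition fisher_info d (X : measurableType d) (R : realType) (I : eqType)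
    (mu : {measure set X -> \bar R}) (f : (I -> R) -> X -> R)
    (theta : I -> R) (i j : I) : \bar R :=
  (\int[mu]_x (partial (fun th => ln (f th x)) theta i *
               partial (fun th => ln (f th x)) theta j * f theta x)%:E)%E.

Definition expmx (R : realType) (p : nat) (U : 'M[R]_p) : 'M[R]_p :=
  lim (series (fun k : nat => (k`!%:R)^-1 *: U ^+ k) @ \oo).

(* Index pairs (s, t) with s < t. *)
Definition upair (p : nat) := {st : 'I_p * 'I_p | (st.1 < st.2)%N}.

Definition mk_upair (p : nat) (s t : 'I_p) (hst : (s < t)%N) : upair p :=
  exist _ (s, t) hst.

(* insub (i, j) is Some exactly when i < j: entry u_ij above the diagonal,
   - u_ji below it, 0 on it. *)
Definition skewmx (R : realType) (p : nat) (u : upair p -> R) : 'M[R]_p :=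
  \matrix_(i, j)
    if insub (i, j) is Some ij then u ij
    else if insub (j, i) is Some ji then - u ji
    else 0.

(* inl a indexes the coordinate lambda_a, inr (s, t) the coordinate u_st. *)
Definition spectral_index (p : nat) := ('I_p + upair p)%type.

Definition spectral_chart (R : realType) (p : nat) (Gamma : 'M[R]_p)
    (theta : spectral_index p -> R) : 'M[R]_p :=
  let Lambda := diag_mx (\row_a theta (inl a)) in
  let E := expmx (skewmx (fun st => theta (inr st))) in
  Gamma *m E *m Lambda *m E^T *m Gamma^T.

(* Coordinates (lambda, u = 0) of the point (lambda, Gamma) in the chart centred
   at Gamma. *)
Definition spectral_point (R : realType) (p : nat) (lambda : 'I_p -> R)
    (k : spectral_index p) : R :=
  match k with inl a => lambda a | inr _ => 0 end.

Definition spectral_metric (R : realType) (p : nat) (lambda : 'I_p -> R)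
    (Gamma : 'M[R]_p) : spectral_index p -> spectral_index p -> \bar R :=
  fisher_info (lebesgue_tuple R p)
    (fun theta => normal0_pdf (spectral_chart Gamma theta))
    (spectral_point lambda).

(* Main.v *)
(** Write z for the whitened observation diag(lambda)^(-1/2) Gamma^t x.  Along
    the coordinate u_st the matrix exp(U) is a plane rotation, so every
    coordinate derivative of the log-likelihood at (lambda, Gamma) is explicit:
    it is a constant times a product of Hermite polynomials He_d(z_i) over the
    coordinates i, with d = 2 at a for lambda_a and d = 1 at s and t for u_st.
    Since z is a standard normal vector, orthogonality of the Hermite
    polynomials makes the metric diagonal and gives the diagonal entries.  That
    z is standard normal is the linear change of variables for Lebesgue measure
    on tuples, obtained from block shears by Tonelli's theorem. *)
Require Import Defs.
From mathcomp Require Import all_boot all_order all_algebra.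
From mathcomp Require Import all_classical all_reals all_analysis.
From mathcomp Require Import measurable_realfun ring lra.

Set Implicit Arguments.
Unset Strict Implicit.
Unset Printing Implicit Defensive.

Import Order.TTheory GRing.Theory Num.Theory.
Import numFieldNormedType.Exports.

Local Open Scope classical_set_scope.
Local Open Scope ring_scope.

(** * Linear change of variables *)

(** Lebesgue measure is characterised by its values on half-open intervals, and there it agrees with
    [|a|] times its own image under [x |-> a * x + b]. *)
Lemma ge0_integral_affine (R : realType) (a b : R) (f : measurableTypeR R -> \bar R) :
  a != 0 -> measurable_fun setT f -> (forall x, 0 <= f x)%E ->
  (\int[@lebesgue_measure R]_x f (a * x + b)%R =
   `|a|^-1%:E * \int[@lebesgue_measure R]_x f x)%E.
Proof.
move=> a0 mf f0.
pose phi (x : measurableTypeR R) : measurableTypeR R := a * x + b.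
have mphi : measurable_fun setT phi.
  by apply: measurable_funD => //; exact: measurable_funM.
pose mu_ : {measure set (measurableTypeR R) -> \bar R} := mscale (NngNum (normr_ge0 a))
  (pushforward (@lebesgue_measure R) phi).
pose mu := mu_ mphi.
have muE (A : set (measurableTypeR R)) : measurable A -> lebesgue_measure A = mu A.
  move=> mA; apply: lebesgue_measure_unique => //= _ [[x y] _ <-] /=.
  rewrite /mu /mu_ /= /mscale /= /pushforward.
  have [a_lt0|a_gt0|/eqP] := ltgtP a 0; last by rewrite (negbTE a0).
  (* For negative [a] the preimage of []x, y]] is closed on the left and open on the right, with the
     same length. *)
  - rewrite (_ : _ @^-1` _ = `[(y - b) / a, (x - b) / a[%classic); last first.
      apply/seteqP; split => z /=;
        rewrite !in_itv/= /phi ler_ndivrMr// ltr_ndivlMr// =>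
        /andP[? ?]; apply/andP; split; lra.
    rewrite !lebesgue_measure_itv/= !lte_fin ltr_ndivrMr// divfK// ltrD2r.
    case: ifPn => _; last by rewrite mule0.
    by rewrite -!EFinD -EFinM ltr0_norm//; congr EFin; field.
  - rewrite (_ : _ @^-1` _ = `](x - b) / a, (y - b) / a]%classic); last first.
      apply/seteqP; split => z /=;
        rewrite !in_itv/= /phi ltr_pdivrMr// ler_pdivlMr// =>
        /andP[? ?]; apply/andP; split; lra.
    rewrite !lebesgue_measure_itv/= !lte_fin ltr_pdivrMr// divfK// ltrD2r.
    case: ifPn => _; last by rewrite mule0.
    by rewrite -!EFinD -EFinM gtr0_norm//; congr EFin; field.
rewrite [in RHS](eq_measure_integral mu); last by move=> A mA _; exact: muE.
rewrite ge0_integral_mscale//= muleA -EFinM mulVf ?normr_eq0// mul1e.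
by rewrite ge0_integral_pushforward.
Qed.

Lemma tuple_integralS (R : realType) (n : nat)
    (f : n.+1.-tuple (measurableTypeR R) -> \bar R) :
  measurable_fun setT f -> (forall x, 0 <= f x)%E ->
  (\int[lebesgue_tuple R n.+1]_x f x =
   \int[@lebesgue_measure R]_x \int[lebesgue_tuple R n]_t f (tuple_cons (x, t)))%E.
Proof.
move=> mf f0.
rewrite [LHS](@ge0_integral_pushforward _ _ _ _ R _
  (@measurable_tuple_cons _ (measurableTypeR R) n)) //=.
rewrite fubini_tonelli1//=.
by apply: measurableT_comp => //; exact: measurable_tuple_cons.
Qed.

(** Integrating the head innermost suits maps that move the head by an amount depending on the
    tail. *)
Lemma tuple_integralSC (R : realType) (n : nat)
    (f : n.+1.-tuple (measurableTypeR R) -> \bar R) :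
  measurable_fun setT f -> (forall x, 0 <= f x)%E ->
  (\int[lebesgue_tuple R n.+1]_x f x =
   \int[lebesgue_tuple R n]_t \int[@lebesgue_measure R]_x f (tuple_cons (x, t)))%E.
Proof.
move=> mf f0; rewrite tuple_integralS//.
rewrite (@fubini_tonelli _ _ (measurableTypeR R) _ R (@lebesgue_measure R)
  (lebesgue_tuple R n) (f \o @tuple_cons _ _ n))//=.
by apply: measurableT_comp => //; exact: measurable_tuple_cons.
Qed.

(** Tuples carry the measure and columns carry the linear algebra; [tuple_col] and [col_tuple] pass
    between the two. *)
Definition tuple_col (R : realType) n (x : n.-tuple (measurableTypeR R)) : 'cV[R]_n :=
  \col_i tnth x i.

Definition col_tuple (R : realType) n (v : 'cV[R]_n) : n.-tuple (measurableTypeR R) :=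
  [tuple v i 0 | i < n].

Lemma tuple_colK (R : realType) n : cancel (@tuple_col R n) (@col_tuple R n).
Proof. by move=> x; apply: eq_from_tnth => i; rewrite tnth_mktuple mxE. Qed.

Lemma col_tupleK (R : realType) n : cancel (@col_tuple R n) (@tuple_col R n).
Proof. by move=> v; apply/colP => i; rewrite mxE tnth_mktuple. Qed.

Lemma tuple_col_cons (R : realType) n (x : R) (t : n.-tuple (measurableTypeR R)) :
  tuple_col (tuple_cons ((x : measurableTypeR R), t)) = col_mx x%:M (tuple_col t) :> 'cV_(1 + n).
Proof.
apply/colP => i; rewrite !mxE; case: splitP => j ij.
  by rewrite (_ : i = ord0) ?tnth0 ?ord1 ?mxE//; apply: val_inj; rewrite /= ij ord1.
rewrite (_ : i = lift ord0 j) ?tnthS ?mxE//; last exact: val_inj.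
Qed.

Lemma col_tuple_col_mx (R : realType) n (x : 'cV[R]_1) (v : 'cV[R]_n) :
  @col_tuple R (1 + n) (col_mx x v) = tuple_cons ((x 0 0 : measurableTypeR R), col_tuple v).
Proof.
by apply: (can_inj (@tuple_colK R _)); rewrite tuple_col_cons !col_tupleK -mx11_scalar.
Qed.

Lemma measurable_affine (R : realType) m n (M : 'M[R]_(m, n)) (v : 'cV[R]_m) :
  measurable_fun setT (fun x => col_tuple (M *m tuple_col x + v)).
Proof.
apply/measurable_fun_tnthP => i.
apply: (@eq_measurable_fun _ _ _ _ _
  (fun x => \sum_j M i j * tnth x j + v i 0 : measurableTypeR R)) => [x _|].
  by rewrite /= tnth_mktuple !mxE; congr (_ + _); apply: eq_bigr => j _; rewrite ?mxE.
apply: measurable_funD => //; apply: measurable_sum => j.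
by apply: measurable_funM => //; exact: measurable_tnth.
Qed.

Section ChangeOfVariables.
Context (R : realType).
Local Notation T := (measurableTypeR R).
Local Notation leb := (@lebesgue_measure R).
Local Notation lebn := (lebesgue_tuple R).

Section Sections.
Variables (n : nat) (f : n.+1.-tuple T -> \bar R).
Hypotheses (mf : measurable_fun setT f) (f0 : forall x, (0 <= f x)%E).

Lemma measurable_tuple_section x :
  measurable_fun setT (fun t : n.-tuple T => f (tuple_cons (x, t))).
Proof.
apply: (measurableT_comp mf).
exact: (measurable_cons (measurable_cst x) (@measurable_id _ _ setT)).
Qed.

Lemma measurable_tuple_sectionC t :
  measurable_fun setT (fun x : T => f (tuple_cons (x, t))).
Proof.
apply: (measurableT_comp mf).
exact: (measurable_cons (@measurable_id _ T setT) (measurable_cst t)).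
Qed.

Lemma measurable_tuple_integral :
  measurable_fun setT (fun x : T => \int[lebn n]_t f (tuple_cons (x, t)))%E.
Proof.
apply: (@measurable_fun_fubini_tonelli_F _ _ T _ R (lebn n) (f \o @tuple_cons _ T n)) => //=.
by apply: (measurableT_comp mf); exact: measurable_tuple_cons.
Qed.

End Sections.

(** Induction on [n]: at a fixed head the tail is translated, which the induction hypothesis
    absorbs; the head is then an affine substitution of slope 1. *)
Lemma ge0_integral_tuple_translate n (v : 'cV[R]_n) (f : n.-tuple T -> \bar R) :
  measurable_fun setT f -> (forall x, 0 <= f x)%E ->
  (\int[lebn n]_x f (col_tuple (tuple_col x + v)) = \int[lebn n]_x f x)%E.
Proof.
elim: n v f => [|n IH] v f mf f0.
  by apply: eq_integral => x _; congr f; apply: eq_from_tnth => -[].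
have mfv : measurable_fun setT (fun x => f (col_tuple (tuple_col x + v))).
  apply: (measurableT_comp mf).
  by have := measurable_affine 1%:M v; under eq_fun do rewrite mul1mx.
rewrite !tuple_integralS//.
change 'cV[R]_(1 + n) in v.
have E (x : T) (t : n.-tuple T) : col_tuple (tuple_col (tuple_cons (x, t)) + v) =
    tuple_cons (x + v ord0 0 : T, col_tuple (tuple_col t + dsubmx v)).
  have -> : tuple_col (tuple_cons (x, t)) + v =
      col_mx (x%:M + usubmx v) (tuple_col t + dsubmx v) :> 'cV_(1 + n).
    by rewrite -add_col_mx vsubmxK tuple_col_cons.
  by rewrite col_tuple_col_mx !mxE /= mulr1n lshift0.
under eq_integral => x _ do under eq_integral => t _ do rewrite E.
under eq_integral => x _.
  rewrite (IH (dsubmx v) (fun t => f (tuple_cons (x + v ord0 0, t)))) //;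
    last exact: measurable_tuple_section.
  over.
have mF := measurable_tuple_integral mf f0.
have F0 (x : T) : (0 <= \int[lebn n]_t f (tuple_cons (x, t)))%E by exact: integral_ge0.
have := ge0_integral_affine (v ord0 0) (oner_neq0 R) mF F0.
rewrite normr1 invr1 mul1e => <-.
by apply: eq_integral => x _; rewrite mul1r.
Qed.

(** The change of variables formula is phrased as a property of [M] so that it can be proved for
    shears and scalings and then carried through products. *)
Definition scales_lebesgue n (M : 'M[R]_n) := forall f : n.-tuple T -> \bar R,
  measurable_fun setT f -> (forall x, 0 <= f x)%E ->
  (\int[lebn n]_x f (col_tuple (M *m tuple_col x)) =
   `|\det M|^-1%:E * \int[lebn n]_x f x)%E.

Lemma measurable_linear m n (M : 'M[R]_(m, n)) :
  measurable_fun setT (fun x => col_tuple (M *m tuple_col x)).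
Proof. by have := measurable_affine M 0; under eq_fun do rewrite addr0. Qed.

Lemma scales_lebesgueM n (M N : 'M[R]_n) :
  scales_lebesgue M -> scales_lebesgue N -> scales_lebesgue (M *m N).
Proof.
move=> HM HN f mf f0.
have := HN (fun x => f (col_tuple (M *m tuple_col x))).
under eq_integral do rewrite col_tupleK mulmxA.
move=> -> //; last by apply: (measurableT_comp mf); exact: measurable_linear.
by rewrite HM// muleA -EFinM det_mulmx normrM invfM mulrC.
Qed.

Lemma scales_lebesgue1 n : scales_lebesgue (1%:M : 'M[R]_n).
Proof.
move=> f _ _; rewrite det1 normr1 invr1 mul1e.
by apply: eq_integral => x _; rewrite mul1mx tuple_colK.
Qed.

(** With the head [x] fixed, the tail undergoes [D] followed by a translation by [x *: c];
    translation invariance removes the latter, and the head is then rescaled by [a]. *)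
Lemma scales_lebesgue_lower n (a : R) (c : 'cV[R]_n) (D : 'M[R]_n) : a != 0 ->
  scales_lebesgue D ->
  @scales_lebesgue (1 + n) (block_mx a%:M 0 c D).
Proof.
move=> a0 HD f mf f0.
have mfM : measurable_fun setT
    (fun x => f (col_tuple (block_mx a%:M 0 c D *m @tuple_col R (1 + n) x))).
  by apply: (measurableT_comp mf); exact: measurable_linear.
rewrite !tuple_integralS//.
have E (x : T) (t : n.-tuple T) :
    col_tuple (block_mx a%:M 0 c D *m @tuple_col R (1 + n) (tuple_cons (x, t))) =
    tuple_cons (a * x : T, col_tuple (D *m tuple_col t + x *: c)).
  rewrite tuple_col_cons mul_block_col mul0mx addr0 -scalar_mxM.
  by rewrite col_tuple_col_mx mxE eqxx mulr1n mul_mx_scalar addrC.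
under eq_integral => x _ do under eq_integral => t _ do rewrite E.
have inner (x : T) :
    (\int[lebn n]_t f (tuple_cons ((a * x)%R : T, col_tuple (D *m tuple_col t + x *: c)%R)) =
     `|\det D|^-1%:E * \int[lebn n]_t f (tuple_cons ((a * x)%R : T, t)))%E.
  have mfx := measurable_tuple_section mf (a * x : T).
  rewrite -(ge0_integral_tuple_translate (x *: c) mfx)//.
  rewrite -(HD (fun t => f (tuple_cons (a * x : T, col_tuple (tuple_col t + x *: c)))))//.
    by apply: eq_integral => t _; rewrite col_tupleK.
  apply: (measurableT_comp mfx).
  by have := measurable_affine 1%:M (x *: c); under eq_fun do rewrite mul1mx.
under eq_integral => x _ do rewrite inner.
have mF := measurable_tuple_integral mf f0.
have F0 (x : T) : (0 <= \int[lebn n]_t f (tuple_cons (x, t)))%E by exact: integral_ge0.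
rewrite ge0_integralZl//; last first.
  apply: (measurableT_comp mF); exact: measurable_funM.
under eq_integral do rewrite -[(a * _)%R]addr0.
rewrite (ge0_integral_affine 0 a0 mF F0) muleA -EFinM; congr (_%:E * _)%E.
by rewrite det_lblock det_scalar1 normrM invfM mulrC.
Qed.

(** With the tail fixed, the head is merely translated, so the head is integrated first. *)
Lemma scales_lebesgue_upper n (r : 'rV[R]_n) :
  @scales_lebesgue (1 + n) (block_mx 1%:M r 0 1%:M).
Proof.
move=> f mf f0.
have mfM : measurable_fun setT
    (fun x => f (col_tuple (block_mx 1%:M r 0 1%:M *m @tuple_col R (1 + n) x))).
  by apply: (measurableT_comp mf); exact: measurable_linear.
rewrite !tuple_integralSC//.
have E (x : T) (t : n.-tuple T) :
    col_tuple (block_mx 1%:M r 0 1%:M *m @tuple_col R (1 + n) (tuple_cons (x, t))) =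
    tuple_cons (1 * x + (r *m tuple_col t) 0 0 : T, t).
  rewrite tuple_col_cons mul_block_col mul0mx add0r !mul1mx.
  by rewrite col_tuple_col_mx 2!mxE eqxx mulr1n mul1r tuple_colK.
under eq_integral => t _ do under eq_integral => x _ do rewrite E.
rewrite det_ublock !det1 mulr1 normr1 invr1 mul1e.
apply: eq_integral => t _.
rewrite (ge0_integral_affine _ (f := fun x => f (tuple_cons (x, t)))) ?oner_neq0//.
  by rewrite normr1 invr1 mul1e.
exact: measurable_tuple_sectionC.
Qed.

(** One step of Gaussian elimination; the lower right block of the first factor is the Schur
    complement of [a]. *)
Lemma block_mx_pivot n (a : R) (r : 'rV[R]_n) (c : 'cV[R]_n) (D : 'M[R]_n) : a != 0 ->
  block_mx a%:M r c D =
  block_mx a%:M 0 c (D - a^-1 *: (c *m r)) *m block_mx 1%:M (a^-1 *: r) 0 1%:M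
  :> 'M[R]_(1 + n).
Proof.
move=> a0; rewrite mulmx_block !mulmx0 !mulmx1 !addr0 mul_scalar_mx scalerA divff// scale1r.
by rewrite -scalemxAr addrC subrK.
Qed.

Lemma scales_lebesgue_pivot n (a : R) (r : 'rV[R]_n) (c : 'cV[R]_n) (D : 'M[R]_n) :
  a != 0 -> scales_lebesgue (D - a^-1 *: (c *m r)) ->
  @scales_lebesgue (1 + n) (block_mx a%:M r c D).
Proof.
move=> a0 HD.
rewrite block_mx_pivot//.
by apply: scales_lebesgueM; [exact: scales_lebesgue_lower|exact: scales_lebesgue_upper].
Qed.

(** Induction on the size. A nonzero corner entry reduces the claim to its Schur complement, which
    is again invertible because the determinant is the corner entry times that of the complement. *)
Lemma unitmx_scales_lebesgue n (M : 'M[R]_n) : M \in unitmx -> scales_lebesgue M.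
Proof.
elim: n M => [|n IH] M Mu.
  move=> f _ _; rewrite det_mx00 normr1 invr1 mul1e.
  by apply: eq_integral => x _; congr f; apply: eq_from_tnth => -[].
have pivot a (r : 'rV[R]_n) c D : a != 0 -> (block_mx a%:M r c D : 'M[R]_(1 + n)) \in unitmx ->
    @scales_lebesgue (1 + n) (block_mx a%:M r c D).
  move=> a0 Bu; apply: scales_lebesgue_pivot => //; apply: IH.
  move: Bu; rewrite block_mx_pivot// !unitmxE.
  by rewrite det_mulmx det_ublock !det1 mulr1 mulr1 det_lblock unitrM => /andP[].
change 'M[R]_(1 + n) in M; change (is_true (M \in @unitmx R (1 + n))) in Mu.
move: Mu; rewrite -(submxK M) (mx11_scalar (ulsubmx M)).
move: (ulsubmx M 0 0) (ursubmx M) (dlsubmx M) (drsubmx M) => {M} a r c D Mu.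
have [a0|a0] := eqVneq a 0; last exact: pivot.
(* A zero pivot becomes [r *m r^T] after a right multiplication by a shear. *)
rewrite a0 raddf0 in Mu *.
(* With a zero corner, [r = 0] would make the first row vanish; hence the sum of the squares of the
   entries of [r] is nonzero and can serve as a pivot. *)
have ss0 : (r *m r^T) 0 0 != 0.
  apply: contraTneq Mu => rr0.
  suff -> : r = 0 by rewrite unitmxE det_lblock det0 mul0r unitr0.
  apply/rowP => j; rewrite mxE; apply/eqP; rewrite -sqrf_eq0; apply/eqP.
  move/eqP: rr0; rewrite mxE psumr_eq0 => [/allP/(_ j)|i _].
    by rewrite mem_index_enum !mxE => /(_ isT)/eqP.
  by rewrite mxE -expr2 sqr_ge0.
have shear (v : 'cV[R]_n) : @scales_lebesgue (1 + n) (block_mx 1%:M 0 v 1%:M).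
  by apply: scales_lebesgue_lower; [exact: oner_neq0|exact: scales_lebesgue1].
have ML (v : 'cV[R]_n) : block_mx 0 r c D *m block_mx 1%:M 0 v 1%:M =
    block_mx (r *m v) r (c + D *m v) D :> 'M[R]_(1 + n).
  by rewrite mulmx_block !mulmx0 !mulmx1 ?mul0mx ?add0r.
have -> : block_mx 0 r c D = block_mx (r *m r^T) r (c + D *m r^T) D *m
    block_mx 1%:M 0 (- r^T) 1%:M :> 'M[R]_(1 + n).
  by rewrite mulmx_block !mulmx0 !mulmx1 ?add0r !mulmxN subrr addrK.
apply: scales_lebesgueM => //; rewrite [r *m r^T]mx11_scalar; apply: pivot => //.
rewrite -mx11_scalar -ML unitmx_mul Mu unitmxE det_lblock !det1 mulr1.
exact: unitr1.
Qed.

End ChangeOfVariables.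

(** * Integrals of product functions *)

Section ProductFunctions.
Local Open Scope ereal_scope.
Context d1 d2 (T1 : measurableType d1) (T2 : measurableType d2) (R : realType).
Variables (m1 : {sigma_finite_measure set T1 -> \bar R}).
Variables (m2 : {sigma_finite_measure set T2 -> \bar R}).
Variables (f : T1 -> R) (g : T2 -> R).
Hypotheses (intf : m1.-integrable setT (EFin \o f)).
Hypotheses (intg : m2.-integrable setT (EFin \o g)).

Lemma integrable_tensor :
  (m1 \x m2).-integrable setT (fun z => (f z.1 * g z.2)%:E).
Proof.
have mf := measurable_int _ intf; have mg := measurable_int _ intg.
apply/integrable12ltyP.
  apply/measurable_EFinP/measurable_funM.
    by apply: (measurableT_comp _ measurable_fst); exact/measurable_EFinP.
  by apply: (measurableT_comp _ measurable_snd); exact/measurable_EFinP.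
have /integrableP[_ foo] := intf; have /integrableP[_ goo] := intg.
have nmf : measurable_fun setT (fun x => `|f x|%:E) by apply: (measurableT_comp (f := abse) _ mf).
have nmg : measurable_fun setT (fun x => `|g x|%:E) by apply: (measurableT_comp (f := abse) _ mg).
under eq_integral => x _.
  under eq_integral => y _ do rewrite /= normrM EFinM.
  rewrite ge0_integralZl//.
  over.
rewrite ge0_integralZr//; last exact: integral_ge0.
by rewrite lte_mul_pinfty// ?integral_ge0// ge0_fin_numE// integral_ge0.
Qed.

Lemma integral_tensor :
  \int[m1 \x m2]_z (f z.1 * g z.2)%:E =
  \int[m1]_x (f x)%:E * \int[m2]_y (g y)%:E.
Proof.
rewrite -integral12_prod_meas1; last exact: integrable_tensor.
rewrite /fubini_F.
under eq_integral => x _.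
  under eq_integral => y _ do rewrite /= EFinM.
  rewrite integralZl//.
  over.
rewrite -(fineK (integrable_fin_num measurableT intg)).
by rewrite integralZr.
Qed.

End ProductFunctions.

Section TupleIntegrals.
Context (R : realType).
Local Notation T := (measurableTypeR R).
Local Notation leb := (@lebesgue_measure R).
Local Notation lebn := (lebesgue_tuple R).

(** The nonnegative case is applied to the positive and negative parts; integrability makes the
    difference of their integrals well defined. *)
Lemma integral_linear n (M : 'M[R]_n) (F : n.-tuple T -> \bar R) :
  M \in unitmx -> (lebn n).-integrable setT F ->
  (\int[lebn n]_x F (col_tuple (M *m tuple_col x)) =
   `|\det M|^-1%:E * \int[lebn n]_x F x)%E.
Proof.
move=> Mu intF; have mF := measurable_int _ intF.
rewrite integralE [in RHS]integralE muleBr//; last first.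
  by rewrite fin_num_adde_defr// ?integrable_pos_fin_num.
have mFp := measurable_funepos mF; have mFn := measurable_funeneg mF.
rewrite -(unitmx_scales_lebesgue Mu mFp) ?funepos_ge0//.
rewrite -(unitmx_scales_lebesgue Mu mFn); last by move=> x; exact: funeneg_ge0.
by congr (_ - _)%E; apply: eq_integral => x _; rewrite ?funeposE ?funenegE.
Qed.

(** Integrability and value go through the induction together, since Fubini at each stage needs the
    tail product to be integrable. *)
Lemma integrable_integral_tuple_prod n (h : 'I_n -> R -> R) (m : 'I_n -> R) :
  (forall i, leb.-integrable setT (EFin \o h i)) ->
  (forall i, \int[leb]_x (h i x)%:E = (m i)%:E)%E ->
  (lebn n).-integrable setT (fun x => (\prod_i h i (tnth x i))%:E) /\
  (\int[lebn n]_x (\prod_i h i (tnth x i))%:E = (\prod_i m i)%:E)%E.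
Proof.
elim: n h m => [|n IH] h m inth hm.
  split.
    apply: (eq_integrable _ (cst 1%E)) => //=.
      by move=> x _; rewrite big_ord0.
    exact: (finite_measure_integrable_cst \d_[tuple] 1).
  under eq_integral do rewrite big_ord0.
  by rewrite integral_dirac// diracT mul1e big_ord0.
have [intG GE] := IH (fun i => h (lift ord0 i)) (fun i => m (lift ord0 i))
  (fun i => inth (lift ord0 i)) (fun i => hm (lift ord0 i)).
have mF : measurable_fun setT
    (fun x : n.+1.-tuple T => (\prod_i h i (tnth x i))%:E).
  apply/measurable_EFinP; apply: measurable_prod => i _.
  have mhi : measurable_fun setT (h i : T -> R).
    by have /measurable_int/measurable_EFinP := inth i.
  exact: (measurableT_comp mhi (@measurable_tnth _ T _ i)).
have E (z : T * n.-tuple T) : (\prod_i h i (tnth (tuple_cons z) i))%:E =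
    (h ord0 z.1 * \prod_i h (lift ord0 i) (tnth z.2 i))%:E.
  by rewrite big_ord_recl tnth0; congr (_ * _)%:E; apply: eq_bigr => i _; rewrite tnthS.
have intFc := integrable_tensor (inth ord0) intG.
have := integral_tensor (inth ord0) intG.
under eq_integral do rewrite -E.
rewrite hm GE => intE; rewrite big_ord_recl EFinM.
pose F (x : n.+1.-tuple T) := (\prod_i h i (tnth x i))%:E.
have mcons := @measurable_tuple_cons _ T n.
have intF : (leb \x lebn n)%E.-integrable setT (F \o @tuple_cons _ T n).
  by apply: eq_integrable intFc => // z _; rewrite -E.
split.
  exact: (integrable_pushforward mcons mF intF).
rewrite [LHS](integral_pushforward mcons mF intF measurableT).
by rewrite -intE.
Qed.

End TupleIntegrals.

(** * Moments of the standard normal law *)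

Section FTC_line.
Context (R : realType).
Local Notation leb := (@lebesgue_measure R).

(** The fundamental theorem of calculus on [[-n, n]] gives the difference of the boundary values,
    and dominated convergence with bound [|f|] lets the interval grow to the line. *)
Lemma integral_derivative_eq0 (F f : R -> R) :
  continuous f -> (forall x : R, is_derive x 1 F (f x)) ->
  leb.-integrable setT (EFin \o f) ->
  F n%:R @[n --> \oo] --> 0 -> F (- n%:R) @[n --> \oo] --> 0 ->
  (\int[leb]_x (f x)%:E = 0)%E.
Proof.
move=> cf Ff intf Fy FNy.
pose fn (n : nat) : R -> \bar R := (EFin \o f) \_ `[- n%:R, n%:R].
have mf : measurable_fun setT (EFin \o f) by exact: measurable_int intf.
have mfn n : measurable_fun setT (fn n).
  apply/(measurable_restrictT _ _).1 => //.
  exact: measurable_funS mf.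
have fnf : {ae leb, forall x, setT x -> fn n x @[n --> \oo] --> (f x)%:E}.
  apply: aeW => x _; apply: cvg_near_cst.
  near=> n; rewrite /fn patchE ifT// inE/= in_itv/= -ler_norml.
  by near: n; exact: nbhs_infty_ger.
have fnle : {ae leb, forall x, forall n, setT x -> (`|fn n x| <= `|(f x)%:E|)%E}.
  apply: aeW => x n _; rewrite /fn patchE; case: ifPn => //=.
  by rewrite normr0 lee_fin normr_ge0.
have [_ _ H] := @dominated_convergence _ (measurableTypeR R) R leb setT measurableT fn _ _
  mfn mf fnf (integrable_abse intf) fnle.
(* The index is shifted because the fundamental theorem is applied to a nondegenerate interval. *)
have E n : (\int[leb]_x fn n.+1 x = (F n.+1%:R - F (- n.+1%:R))%:E)%E.
  rewrite -integral_mkcond.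
  apply: (continuous_FTC2 (F := F)).
  - by rewrite -subr_gt0 opprK -mulr2n pmulrn_rgt0// ltr0n.
  - exact: continuous_subspaceT.
  - split.
    + by move=> x _; exact: ex_derive.
    + apply/cvg_at_right_filter/differentiable_continuous/derivable1_diffP; exact: ex_derive.
    + apply/cvg_at_left_filter/differentiable_continuous/derivable1_diffP; exact: ex_derive.
  - by move=> x _; rewrite derive1E; exact: derive_val.
have : (\int[leb]_x fn n.+1 x @[n --> \oo] --> \int[leb]_x (f x)%:E)%E.
  by have := H; rewrite -(cvg_shiftS (fun n => \int[leb]_x fn n x)%E).
under eq_fun do rewrite E.
move=> /cvg_lim <- //; apply/cvg_lim => //.
apply/cvg_EFin; first by near=> n.
have /= := cvgB Fy FNy; rewrite subr0 -(cvg_shiftS (fun n => _ - _)).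
by apply.
Unshelve. all: by end_near. Qed.

End FTC_line.

Section NormalMoments.
Context (R : realType).
Local Notation leb := (@lebesgue_measure R).
Local Notation phi := (@normal_pdf R 0 1).

Lemma std_normal_pdfE x : phi x = (Num.sqrt (2 * pi))^-1 * expR (- (2^-1 * x ^+ 2)).
Proof.
rewrite normal_pdfE ?oner_neq0//= /normal_peak /normal_fun subr0 expr1n mul1r -mulr_natl.
by congr (_ * expR _); rewrite mulNr mulrC.
Qed.

(** The factor [4 ^+ k.+1 * k.+1]![comes from]y ^+ m / m[! <= expR y] with [y = x ^+ 2 / 4] and
    [m = k.+1]; the summand 1 covers [|x| <= 1]. *)
Definition tail_const k : R := 1 + 4 ^+ k.+1 * k.+1`!%:R.

Lemma normr_exp_le k (x : R) : `|x| ^+ k <= tail_const k * expR (x ^+ 2 / 4).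
Proof.
have x2 : 0 <= x ^+ 2 / 4 by rewrite divr_ge0// sqr_ge0.
have e1 : 1 <= expR (x ^+ 2 / 4) by rewrite (le_trans _ (expR_ge1Dx _)) ?lerDl.
rewrite /tail_const mulrDl mul1r.
have [x1|x1] := leP `|x| 1.
  rewrite (le_trans (exprn_ile1 _ (normr_ge0 x) x1))// (le_trans e1)// lerDl.
  by rewrite !mulr_ge0 ?exprn_ge0 ?expR_ge0.
have : `|x| ^+ k <= (x ^+ 2) ^+ k.+1.
  rewrite -real_normK ?num_real// -exprM ler_weXn2l// ?ltW//.
  by rewrite mul2n -addnn (leq_trans (leqnSn k))// leq_addr.
move=> /le_trans; apply.
have := expR_ge1Dxn k x2.
rewrite exprMn exprVn => H.
have c0 : (0 : R) < 4 ^+ k.+1 * k.+1`!%:R by rewrite mulr_gt0 ?exprn_gt0 ?ltr0n ?fact_gt0.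
have H2 : (x ^+ 2) ^+ k.+1 / (4 ^+ k.+1 * k.+1`!%:R) <= expR (x ^+ 2 / 4).
  by rewrite invfM mulrA (le_trans _ H)// lerDr.
rewrite (le_trans (y := 4 ^+ k.+1 * k.+1`!%:R * expR (x ^+ 2 / 4)))
  ?lerDr ?expR_ge0//.
by rewrite -ler_pdivrMl// mulrC.
Qed.

(** The exponent [x ^+ 2 / 2] is split in two equal halves: one absorbs the power of [x], the other
    remains as a Gaussian tail. *)
Lemma normr_exp_normal_le k (x : R) :
  `|x ^+ k * phi x| <= tail_const k * (Num.sqrt (2 * pi))^-1 * expR (- (x ^+ 2 / 4)).
Proof.
rewrite std_normal_pdfE !normrM normrX (ger0_norm (expR_ge0 _))
  [`|_^-1|]ger0_norm ?invr_ge0 ?sqrtr_ge0//.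
rewrite mulrCA -mulrA [leRHS]mulrCA  ler_wpM2l ?invr_ge0 ?sqrtr_ge0//.
rewrite (_ : - (2^-1 * x ^+ 2) = - (x ^+ 2 / 4) - (x ^+ 2 / 4)); last by field.
rewrite expRD mulrA ler_wpM2r ?expR_ge0// expRN ler_pdivrMr ?expR_gt0//.
exact: normr_exp_le.
Qed.

Lemma measurable_exp_normal k : measurable_fun setT (fun x : R => x ^+ k * phi x).
Proof.
by apply: measurable_funM; [exact: exprn_measurable|exact: measurable_normal_pdf].
Qed.

Lemma integrable_exp_normal k :
  leb.-integrable setT (fun x : R => (x ^+ k * phi x)%:E).
Proof.
have s2 : Num.sqrt (2 : R) != 0 by rewrite sqrtr_eq0 -ltNge.
(* The dominating function is a multiple of the normal density of variance 2, whose exponent is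
   exactly [- x ^+ 2 / 4]. *)
pose c : R := tail_const k * (Num.sqrt (2 * pi))^-1 / normal_peak (Num.sqrt 2).
apply: (@le_integrable _ (measurableTypeR R) _ leb setT measurableT _
    (fun x => c%:E * (normal_pdf 0 (Num.sqrt 2) x)%:E)%E).
- by apply/measurable_EFinP; exact: (measurable_exp_normal k).
- move=> x _; rewrite -EFinM /= lee_fin (le_trans (normr_exp_normal_le k x))//.
  rewrite (le_trans _ (ler_norm _))// normal_pdfE// /c mulrA divfK ?gt_eqF ?normal_peak_gt0//.
  by rewrite /normal_fun subr0 sqr_sqrtr// (_ : 2 *+ 2 = 4 :> R) ?mulNr//; ring.
- by apply: integrableZl => //; exact: integrable_normal_pdf.
Qed.

(** The hypothesis on [u] covers [n] and [- n] at once, that is, both boundary terms of the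
    integration by parts. *)
Lemma cvg_exp_normal k (u : nat -> R) : (forall n, u n ^+ 2 = n%:R ^+ 2) ->
  u n ^+ k * phi (u n) @[n --> \oo] --> 0.
Proof.
move=> un; apply/cvgr0Pnorm_le => e e0.
pose c := tail_const k * (Num.sqrt (2 * pi))^-1.
have c0 : 0 < c.
  rewrite mulr_gt0 ?invr_gt0 ?sqrtr_gt0 ?mulr_gt0 ?pi_gt0//.
  by rewrite ltr_wpDr// mulr_ge0 ?exprn_ge0.
have H : expR (- (x : R)) @[x --> +oo] --> 0 by exact: cvgr_expR.
have /cvgr0Pnorm_le/(_ (e / c))[|M [_ HM]] := H; first by rewrite divr_gt0.
near=> n.
rewrite (le_trans (normr_exp_normal_le _ _))// -/c -ler_pdivlMl// un.
rewrite -[leLHS]ger0_norm ?expR_ge0// [c^-1 * e]mulrC; apply: HM.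
(* Since [n <= n ^ 2], it is enough that [n / 4] exceeds the threshold [M]. *)
rewrite (@lt_le_trans _ _ (n%:R / 4))//.
  rewrite ltr_pdivlMr//; near: n; exact: nbhs_infty_gtr.
rewrite ler_pM2r// -natrX ler_nat.
by rewrite -[leqLHS]expn1 leq_pexp2l//; near: n; exact: nbhs_infty_gt.
Unshelve. all: by end_near. Qed.

(** The density satisfies [phi' = - x * phi]. At [k = 0] the coefficient [k%:R] removes the term
    where [k.-1] is truncated. *)
Lemma is_derive_exp_normal k (x : R) :
  is_derive x 1 (fun x => x ^+ k * phi x) (k%:R * x ^+ k.-1 * phi x - x ^+ k.+1 * phi x).
Proof.
pose c : R := (Num.sqrt (2 * pi))^-1.
have -> : (fun x => x ^+ k * phi x) =
    (id ^+ k) * (c \*: (expR \o (- (2^-1 \*: (id ^+ 2))))) :> (R -> R).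
  by apply/funext => y; rewrite std_normal_pdfE !fctE.
apply: is_derive_eq.
rewrite std_normal_pdfE -/c !fctE /GRing.scale /= expr1 mulr1.
by rewrite (exprSr x k) -![_ *: _]/(_ * _); field.
Qed.

(** These are the standard normal moments: the double factorial of [k - 1] for even [k], zero for
    odd [k]. *)
Fixpoint normal_moment (k : nat) : R :=
  match k with
  | 0 => 1
  | 1 => 0
  | j.+2 => j.+1%:R * normal_moment j
  end.

(* The derivative of [x ^+ k * phi x] integrates to 0. *)
Lemma integral_exp_normal_rec k :
  (\int[leb]_x (x ^+ k.+1 * phi x)%:E = k%:R%:E * \int[leb]_x (x ^+ k.-1 * phi x)%:E)%E.
Proof.
have cphi : continuous phi by apply: continuous_normal_pdf; rewrite oner_neq0.
have cxphi j : continuous (fun x : R => x ^+ j * phi x).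
  by move=> x; apply: cvgM; [exact: exprn_continuous|exact: cphi].
have ik : leb.-integrable setT (fun x : R => (k%:R%:E * (x ^+ k.-1 * phi x)%:E)%E).
  by apply: integrableZl => //; exact: integrable_exp_normal.
have ik1 := integrable_exp_normal k.+1.
have := @integral_derivative_eq0 R (fun x => x ^+ k * phi x)
  (fun x => k%:R * (x ^+ k.-1 * phi x) - x ^+ k.+1 * phi x).
move=> H.
have : (\int[leb]_x (k%:R * (x ^+ k.-1 * phi x) - x ^+ k.+1 * phi x)%:E = 0)%E.
  apply: H.
  - move=> x; apply: cvgB; last exact: cxphi.
    by apply: cvgM; [exact: cvg_cst|exact: cxphi].
  - by move=> x; rewrite mulrA; exact: is_derive_exp_normal.
  - by apply: eq_integrable (integrableB _ ik ik1).
  - by apply: cvg_exp_normal.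
  - by apply: cvg_exp_normal => n; rewrite sqrrN.
under eq_integral do rewrite EFinB EFinM.
rewrite integralB// integralZl//; last exact: integrable_exp_normal.
have f1 := integrable_fin_num measurableT (integrable_exp_normal k.-1).
have f2 := integrable_fin_num measurableT ik1.
by move/eqP; rewrite sube_eq ?fin_numM// ?add0e => /eqP->.
Qed.

Lemma integral_exp_normal k :
  (\int[leb]_x (x ^+ k * phi x)%:E = (normal_moment k)%:E)%E.
Proof.
have [n] := ubnP k; elim: n k => // n IH [|[|k]] kn.
- by under eq_integral do rewrite expr0 mul1r; rewrite integral_normal_pdf.
- by rewrite integral_exp_normal_rec mul0e.
- by rewrite integral_exp_normal_rec /= IH ?EFinM// -ltnS ltnW.
Qed.

Lemma integrable_integral_poly_normal n (c : nat -> R) :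
  leb.-integrable setT (fun x : R => ((\sum_(i < n) c i * x ^+ i) * phi x)%:E) /\
  (\int[leb]_x ((\sum_(i < n) c i * x ^+ i) * phi x)%:E =
   (\sum_(i < n) c i * normal_moment i)%:E)%E.
Proof.
elim: n => [|n [intn IH]].
  have E (x : R) : ((\sum_(i < 0) c i * x ^+ i) * phi x)%:E = 0%E by rewrite big_ord0 mul0r.
  split; first by apply: eq_integrable (integrable0 _ _) => // x _; rewrite E.
  by under eq_integral do rewrite E; rewrite integral0 big_ord0.
have E (x : R) : ((\sum_(i < n.+1) c i * x ^+ i) * phi x)%:E =
    (((\sum_(i < n) c i * x ^+ i) * phi x)%:E + (c n)%:E * (x ^+ n * phi x)%:E)%E.
  by rewrite big_ord_recr /= mulrDl -mulrA EFinD EFinM.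
have intc : leb.-integrable setT (fun x : R => ((c n)%:E * (x ^+ n * phi x)%:E)%E).
  by apply: integrableZl => //; exact: integrable_exp_normal.
split.
  by apply: eq_integrable (integrableD _ intn intc) => // x _; rewrite E.
under eq_integral do rewrite E.
rewrite integralD// IH integralZl//; last exact: integrable_exp_normal.
by rewrite integral_exp_normal big_ord_recr /= EFinD EFinM.
Qed.

(* The Hermite polynomials of degree k <= 2; larger k give a junk value. *)
Definition hermite (k : nat) (x : R) : R :=
  match k with 0 => 1 | 1 => x | _ => x ^+ 2 - 1 end.

(** Each product is a polynomial of degree at most 4, so its Gaussian integral is a finite
    combination of moments, checked in the nine cases. *)
Lemma integrable_integral_hermite j k : (j <= 2)%N -> (k <= 2)%N ->
  leb.-integrable setT (fun x : R => (hermite j x * hermite k x * phi x)%:E) /\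
  (\int[leb]_x (hermite j x * hermite k x * phi x)%:E = (k`!%:R * (j == k)%:R)%:E)%E.
Proof.
have H (s : seq R) : (forall x, hermite j x * hermite k x = \sum_(i < 5) s`_i * x ^+ i) ->
    \sum_(i < 5) s`_i * normal_moment i = k`!%:R * (j == k)%:R ->
  leb.-integrable setT (fun x : R => (hermite j x * hermite k x * phi x)%:E) /\
  (\int[leb]_x (hermite j x * hermite k x * phi x)%:E = (k`!%:R * (j == k)%:R)%:E)%E.
  move=> sE <-; have [int5 E5] := integrable_integral_poly_normal 5 (nth 0 s).
  split; first by apply: eq_integrable int5 => // x _; rewrite sE.
  by rewrite -E5; apply: eq_integral => x _; rewrite sE.
(* The lists are the coefficients of the nine products, in increasing degree. *)
move: j k H => [|[|[|//]]] [|[|[|//]]] H _ _;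
  [apply: (H [:: 1]) | apply: (H [:: 0; 1]) | apply: (H [:: -1; 0; 1])
  |apply: (H [:: 0; 1]) | apply: (H [:: 0; 0; 1]) | apply: (H [:: 0; -1; 0; 1])
  |apply: (H [:: -1; 0; 1]) | apply: (H [:: 0; -1; 0; 1])
  |apply: (H [:: 1; 0; -2; 0; 1])] => *;
  by rewrite !big_ord_recl big_ord0 /= /bump /= ?factS ?fact0; ring.
Qed.

End NormalMoments.

(** * Scores in spectral coordinates *)

Section Rotation.
Context (R : realType) (n : nat).
Variables (J P : 'M[R]_n.+1).
Hypotheses (JJ : J * J = - P) (JP : J * P = J).

(** [P] is idempotent and [J] acts on its range as the imaginary unit. Even powers of [J] are thus
    signed copies of [P] and odd ones of [J]; only the zeroth power, the identity, leaves the extra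
    term [1 - P]. *)
Lemma rotation_exp_coeff (h : R) k :
  (k`!%:R)^-1 *: (h *: J) ^+ k =
  cos_coeff h k *: P + sin_coeff h k *: J + (k == 0%N)%:R *: (1 - P).
Proof.
have PP : P * P = P by rewrite -{1}[P]opprK -JJ mulNr -mulrA JP JJ opprK.
have J2 j : J ^+ j.*2 = (-1) ^+ j *: P + (j == 0%N)%:R *: (1 - P).
  elim: j => [|j IH]; first by rewrite expr0 !scale1r addrC subrK.
  rewrite doubleS !exprS mulrA JJ IH mulrDr -!scalerAr !mulNr mulrBr mulr1 PP subrr.
  by rewrite oppr0 scaler0 /= scale0r !addr0 scalerN mul1r scaleNr.
rewrite exprZn scalerA; have [ok|ek] := boolP (odd k).
- have -> : J ^+ k = (-1) ^+ k./2 *: J.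
    rewrite -[in LHS](odd_double_half k) ok add1n exprS J2 mulrDr -!scalerAr JP.
    by rewrite mulrBr mulr1 JP subrr scaler0 addr0.
  have k0 : (k == 0%N) = false by case: (k) ok.
  rewrite /cos_coeff /sin_coeff /= ok k0 !mul0r !scale0r add0r addr0 mul1r scalerA.
  have -> : k.-1./2 = k./2 by rewrite -(odd_double_half k) ok /= doubleK uphalf_double.
  by congr (_ *: _); ring.
- have -> : J ^+ k = (-1) ^+ k./2 *: P + (k == 0%N)%:R *: (1 - P).
    rewrite -[in LHS](odd_double_half k) (negbTE ek) add0n J2.
    by case: (k) ek => [|[|?]].
  rewrite scalerDr !scalerA /cos_coeff /sin_coeff /= (negbTE ek) !mul0r scale0r addr0 mul1r.
  congr (_ *: _ + _ *: _); first by rewrite -exprnP; ring.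
  by case: (k) => [|?]; rewrite ?mulr0// expr0 fact0 invr1 !mulr1.
Qed.

Lemma expmx_rotation (h : R) : expmx (h *: J) = cos h *: P + sin h *: J + (1 - P).
Proof.
apply/cvg_lim => //.
have -> : series (fun k : nat => (k`!%:R)^-1 *: (h *: J) ^+ k) =
    (fun m => series (cos_coeff h) m *: P + series (sin_coeff h) m *: J +
      series (fun k => (k == 0%N)%:R) m *: (1 - P)).
  apply/funext => m; rewrite /series /= !scaler_suml -!big_split /=.
  by apply: eq_bigr => k _; exact: rotation_exp_coeff.
apply: cvgD; first apply: cvgD.
- by apply: cvgZr_tmp; rewrite cos.unlock; exact: is_cvg_series_cos_coeff.
- by apply: cvgZr_tmp; rewrite sin.unlock; exact: is_cvg_series_sin_coeff.
(* Only the term of index 0 is nonzero, so the partial sums equal 1 as soon as they are nonempty. *)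
- rewrite -[X in _ --> X]scale1r; apply: cvgZr_tmp; apply: cvg_near_cst.
  near=> m; rewrite /series /= -(@prednK m) ?big_nat_recl//=; last by near: m; exact: nbhs_infty_gt.
  by rewrite big1 ?addr0.
Unshelve. all: by end_near. Qed.

End Rotation.

Lemma det_orthogonal_sqr (R : realType) p (Q : 'M[R]_p) : Q *m Q^T = 1%:M -> (\det Q) ^+ 2 = 1.
Proof. by move=> QQ; rewrite expr2 -{2}det_tr -det_mulmx QQ det1. Qed.

(** * The Gaussian density in an eigenbasis *)

Section Density.
Context (R : realType) (p : nat) (Q : 'M[R]_p) (mu : 'I_p -> R).
Hypotheses (QQ : Q *m Q^T = 1%:M) (mu0 : forall i, 0 < mu i).
Local Notation D := (diag_mx (\row_a mu a)).

Lemma invmx_spectral :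
  invmx (Q *m D *m Q^T) = Q *m diag_mx (\row_a (mu a)^-1) *m Q^T.
Proof.
have QQ' := mulmx1C QQ.
have E : Q *m D *m Q^T *m (Q *m diag_mx (\row_a (mu a)^-1) *m Q^T) = 1%:M.
  rewrite !mulmxA -(mulmxA _ Q^T Q) QQ' mulmx1 -(mulmxA Q) mulmx_diag.
  rewrite (_ : diag_mx _ = 1%:M) ?mulmx1//.
  apply/matrixP => i j; rewrite !mxE.
  by have [->|//] := eqVneq i j; rewrite divff ?gt_eqF.
have [Au _] := mulmx1_unit E.
by rewrite -[LHS]mulmx1 -E mulKmx.
Qed.

(** In the eigenbasis the determinant is a product and the quadratic form a weighted sum of squares,
    so the density factors. [Q] and [mu] are general because the score is computed at nearby points,
    with a moved eigenvalue or a rotated frame. *)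
Lemma normal0_pdf_spectral (x : p.-tuple (measurableTypeR R)) :
  normal0_pdf (Q *m D *m Q^T) x =
  \prod_i ((Num.sqrt (mu i))^-1 *
           normal_pdf 0 1 ((Q^T *m tuple_col x) i 0 / Num.sqrt (mu i))).
Proof.
rewrite /normal0_pdf -/(tuple_col x) invmx_spectral.
have -> : \det (Q *m D *m Q^T) = \prod_i mu i.
  rewrite !det_mulmx det_tr mulrAC -expr2 det_orthogonal_sqr// mul1r det_diag.
  by apply: eq_bigr => i _; rewrite mxE.
set w := Q^T *m tuple_col x.
have -> : ((tuple_col x)^T *m (Q *m diag_mx (\row_a (mu a)^-1) *m Q^T) *m tuple_col x) 0 0 =
    \sum_i w i 0 ^+ 2 / mu i.
  rewrite !mulmxA -(mulmxA _ Q^T) -/w.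
  have -> : (tuple_col x)^T *m Q = w^T by rewrite /w trmx_mul trmxK.
  rewrite mul_mx_diag mxE; apply: eq_bigr => i _.
  by rewrite !mxE expr2 mulrAC.
have -> : (2 * pi) ^+ p * \prod_i mu i = \prod_i (2 * pi * mu i).
  by rewrite big_split /= prodr_const card_ord.
have -> : Num.sqrt (\prod_i (2 * pi * mu i)) = \prod_i Num.sqrt (2 * pi * mu i).
  rewrite [in LHS](eq_bigr (fun i => Num.sqrt (2 * pi * mu i) ^+ 2)); last first.
    by move=> i _; rewrite sqr_sqrtr// !mulr_ge0 ?pi_ge0 ?ltW.
  by rewrite prodrXl sqrtr_sqr ger0_norm// prodr_ge0// => i _; exact: sqrtr_ge0.
rewrite mulr_sumr -sumrN expR_sum -prodfV -big_split /=.
apply: eq_bigr => i _; rewrite std_normal_pdfE sqrtrM ?mulr_ge0 ?pi_ge0// invfM.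
rewrite mulrA [X in X * _]mulrC; congr (_ * expR (- _)).
by rewrite exprMn exprVn sqr_sqrtr// ltW.
Qed.

Lemma ln_normal0_pdf_spectral (x : p.-tuple (measurableTypeR R)) :
  ln (normal0_pdf (Q *m D *m Q^T) x) =
  \sum_i (- ln (Num.sqrt (2 * pi)) - 2^-1 * (ln (mu i) + (Q^T *m tuple_col x) i 0 ^+ 2 / mu i)).
Proof.
have ln_prod (f : 'I_p -> R) : (forall i, 0 < f i) -> ln (\prod_i f i) = \sum_i ln (f i).
  move=> f0; rewrite (eq_bigr (fun i => expR (ln (f i)))) => [|i _]; last by rewrite lnK ?posrE.
  by rewrite -expR_sum expRK.
have s0 i : 0 < Num.sqrt (mu i) by rewrite sqrtr_gt0.
have p0 : 0 < Num.sqrt (2 * pi) :> R by rewrite sqrtr_gt0 mulr_gt0 ?pi_gt0.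
rewrite normal0_pdf_spectral ln_prod => [|i]; last first.
  by rewrite std_normal_pdfE !mulr_gt0 ?invr_gt0 ?expR_gt0.
apply: eq_bigr => i _; rewrite std_normal_pdfE.
rewrite !lnM ?posrE ?mulr_gt0 ?invr_gt0 ?expR_gt0// !lnV ?posrE// expRK.
have -> : ln (mu i) = 2 * ln (Num.sqrt (mu i)).
  by rewrite -[in LHS](sqr_sqrtr (ltW (mu0 i))) lnXn// mulr_natl.
rewrite exprMn exprVn sqr_sqrtr ?ltW//; field.
by rewrite gt_eqF.
Qed.

End Density.

Section Derivatives.
Context (R : realType).

Lemma is_derive_eigenvalue (K w l : R) : 0 < l ->
  is_derive l 1 (fun h => K - 2^-1 * (ln h + w ^+ 2 / h))
    ((2 * l)^-1 * ((w / Num.sqrt l) ^+ 2 - 1)).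
Proof.
move=> l0.
have dln := is_derive1_ln l0.
have dinv := is_deriveV (lt0r_neq0 l0 : id l != 0) (is_derive_id l 1).
have -> : (fun h => K - 2^-1 * (ln h + w ^+ 2 / h)) =
    cst K - 2^-1 \*: (@ln R + w ^+ 2 \*: (fun y => (id y)^-1)) :> (R -> R) by [].
apply: is_derive_eq.
rewrite -![_ *: _]/(_ * _) /= exprMn exprVn sqr_sqrtr ?ltW//.
by field; rewrite gt_eqF.
Qed.

(** To first order at 0 the rotation moves [a] by [- b] and [b] by [a], so the two squares
    contribute [a * b / l] and [- a * b / m]. *)
Lemma is_derive_rotation (K a b l m : R) : l != 0 -> m != 0 ->
  is_derive (0 : R) 1 (fun h => K - 2^-1 * ((cos h * a - sin h * b) ^+ 2 / l)
     - 2^-1 * ((cos h * b + sin h * a) ^+ 2 / m))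
    (a * b * (l^-1 - m^-1)).
Proof.
move=> l0 m0.
have -> : (fun h => K - 2^-1 * ((cos h * a - sin h * b) ^+ 2 / l)
     - 2^-1 * ((cos h * b + sin h * a) ^+ 2 / m)) =
   cst K - (2^-1 / l) \*: ((a \*: @cos R - b \*: @sin R) ^+ 2) -
   (2^-1 / m) \*: ((b \*: @cos R + a \*: @sin R) ^+ 2) :> (R -> R).
  apply/funext => h; rewrite !fctE /= /GRing.scale /=. ring.
apply: is_derive_eq; rewrite !fctE.
rewrite /GRing.scale /= cos0 sin0 -![_ *: _]/(_ * _); field.
by rewrite l0 m0.
Qed.

End Derivatives.

(** * Rotations in a coordinate plane *)

Section Givens.
Context (R : realType) (p : nat) (s t : 'I_p) (st : (s < t)%N).

(** The infinitesimal rotation in the plane spanned by the basis vectors [s] and [t]; [givens_proj]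
    is the orthogonal projector onto that plane. *)
Definition givens_gen : 'M[R]_p := delta_mx s t - delta_mx t s.
Definition givens_proj : 'M[R]_p := delta_mx s s + delta_mx t t.
Local Notation J := givens_gen.
Local Notation P := givens_proj.

Let neq_st : (s == t) = false.
Proof. by apply/negbTE; rewrite neq_ltn st. Qed.

Let neq_ts : (t == s) = false.
Proof. by rewrite eq_sym neq_st. Qed.

Lemma givens_gen_sqr : J *m J = - P.
Proof.
rewrite mulmxBl !mulmxBr !mul_delta_mx_cond !eqxx neq_st neq_ts !mulr0n !mulr1n.
by rewrite sub0r subr0 opprD.
Qed.

Lemma givens_genP : J *m P = J.
Proof.
rewrite mulmxBl !mulmxDr !mul_delta_mx_cond !eqxx neq_st neq_ts !mulr0n !mulr1n.
by rewrite add0r addr0.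
Qed.

Lemma givens_projJ : P *m J = J.
Proof.
rewrite mulmxDl !mulmxBr !mul_delta_mx_cond !eqxx neq_st neq_ts !mulr0n !mulr1n.
by rewrite subr0 sub0r.
Qed.

Lemma givens_projP : P *m P = P.
Proof.
rewrite mulmxDl !mulmxDr !mul_delta_mx_cond !eqxx neq_st neq_ts !mulr0n !mulr1n.
by rewrite addr0 add0r.
Qed.

Definition givens (h : R) : 'M[R]_p := cos h *: P + sin h *: J + (1%:M - P).

Lemma tr_givens h : (givens h)^T = cos h *: P - sin h *: J + (1%:M - P).
Proof.
have trJ : J^T = - J by rewrite linearB /= !trmx_delta opprB.
have trP : P^T = P by rewrite linearD /= !trmx_delta.
rewrite /givens; move: J P trJ trP => j q trJ trP.
by rewrite !linearD /= linearN /= !linearZ /= trmx1 trJ trP scalerN.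
Qed.

Lemma givens_orthogonal h : givens h *m (givens h)^T = 1%:M.
Proof.
have PQ : P *m (1%:M - P) = 0 by rewrite mulmxBr mulmx1 givens_projP subrr.
have QP : (1%:M - P) *m P = 0 by rewrite mulmxBl mul1mx givens_projP subrr.
have JQ : J *m (1%:M - P) = 0 by rewrite mulmxBr mulmx1 givens_genP subrr.
have QJ : (1%:M - P) *m J = 0 by rewrite mulmxBl mul1mx givens_projJ subrr.
have QQ : (1%:M - P) *m (1%:M - P) = 1%:M - P by rewrite mulmxBl mul1mx PQ subr0.
have PQ1 : P + (1%:M - P) = 1%:M by rewrite addrC subrK.
(* From here only the multiplication table of [P], [J] and [1%:M - P] matters: the mixed products
   with the complement vanish, and the plane part is [cos ^ 2 + sin ^ 2] times [P]. *)
rewrite tr_givens /givens; move: (1%:M - P) PQ1 PQ QP JQ QJ QQ => Q PQ1 PQ QP JQ QJ QQ.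
move: givens_projP givens_projJ givens_genP givens_gen_sqr PQ1 PQ QP JQ QJ QQ.
move: J P => j q qq qj jq jj PQ1 PQ QP JQ QJ QQ.
rewrite !(mulmxDl, mulmxDr) !mulmxN -!scalemxAl -!scalemxAr.
rewrite PQ QP JQ QJ QQ qq qj jq jj !scaler0 ?oppr0 !addr0 ?add0r !scalerN opprK !scalerA.
rewrite [sin h * cos h]mulrC -PQ1; congr (_ + _).
by rewrite addrA subrK -scalerDl -!expr2 cos2Dsin2 scale1r.
Qed.

Lemma givens_trE h (y : 'cV[R]_p) i : ((givens h)^T *m y) i 0 =
  if i == s then cos h * y s 0 - sin h * y t 0
  else if i == t then cos h * y t 0 + sin h * y s 0 else y i 0.
Proof.
have dE a b j : (delta_mx a b *m y) j 0 = (j == a)%:R * y b 0.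
  rewrite mxE (bigD1 b)//= big1 ?addr0 => [|k kb]; rewrite mxE ?eqxx ?andbT//.
  by rewrite (negbTE kb) andbF mul0r.
have PE : (P *m y) i 0 = (i == s)%:R * y s 0 + (i == t)%:R * y t 0.
  by rewrite mulmxDl [LHS]mxE !dE.
have JE : (J *m y) i 0 = (i == s)%:R * y t 0 - (i == t)%:R * y s 0.
  by rewrite mulmxBl [LHS]mxE [X in _ + X]mxE !dE.
rewrite tr_givens; move: J P PE JE => j q PE JE.
have -> : ((cos h *: q - sin h *: j + (1%:M - q)) *m y) i 0 =
    cos h * (q *m y) i 0 - sin h * (j *m y) i 0 + (y i 0 - (q *m y) i 0).
  rewrite !mulmxDl !mulNmx -!scalemxAl mul1mx.
  by move: (q *m y) (j *m y) => v w; rewrite !mxE.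
rewrite PE JE.
have [->|is_] := eqVneq i s; first by rewrite ?eqxx neq_st /=; ring.
by have [->|it] := eqVneq i t; rewrite /=; ring.
Qed.

Lemma skewmx_givens (h : R) :
  Defs.skewmx (dfwith (fun _ : upair p => 0 : R) (mk_upair st) h) = h *: J.
Proof.
have uE (ij : upair p) : dfwith (fun _ : upair p => 0 : R) (mk_upair st) h ij =
    h * (val ij == (s, t))%:R.
  have [->|ne] := eqVneq ij (mk_upair st); first by rewrite dfwithin eqxx mulr1.
  rewrite dfwithout; last by rewrite eq_sym.
  have /negbTE -> : val ij != (s, t).
    by apply: contra_neq ne => e; exact: val_inj.
  by rewrite mulr0.
apply/matrixP => i j; rewrite !mxE.
(* Entries above, below and on the diagonal in turn; since [s < t], at most one of the two
   elementary matrices contributes to each. *)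
case: insubP => [ij /= ltij vij|/= nij].
  rewrite uE [val ij]vij xpair_eqE; have -> : (i == t) && (j == s) = false.
    by apply/negbTE/negP => /andP[/eqP it /eqP js]; move: ltij; rewrite it js ltnNge ltnW.
  by rewrite subr0.
case: insubP => [ji /= ltji vji|/= nji].
  rewrite uE [val ji]vji xpair_eqE [in RHS]andbC; have -> : (j == t) && (i == s) = false.
    by apply/negbTE/negP => /andP[/eqP jt /eqP is_]; move: ltji; rewrite jt is_ ltnNge ltnW.
  by rewrite sub0r mulrN andbC.
have -> : (i == s) && (j == t) = false.
  by apply/negbTE/negP => /andP[/eqP is_ /eqP jt]; move: nij; rewrite is_ jt st.
have -> : (i == t) && (j == s) = false.
  by apply/negbTE/negP => /andP[/eqP it /eqP js]; move: nji; rewrite it js st.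
by rewrite subrr mulr0.
Qed.

End Givens.

Lemma expmx_givens (R : realType) p (s t : 'I_p) (st : (s < t)%N) (h : R) :
  expmx (h *: givens_gen R s t) = givens s t h.
Proof.
(* The exponential of a rotation generator was computed in the ring of matrices of positive size; in
   size 0 there is no index [s]. *)
move: p s t st => [|n] s t st; first by case: (s).
apply: expmx_rotation; first exact: givens_gen_sqr.
exact: givens_genP.
Qed.

Lemma expmx0 (R : realType) p : expmx (0 : 'M[R]_p) = 1%:M.
Proof.
case: p => [|n]; first by apply/matrixP => -[].
(* The degenerate rotation [J = P = 0]. *)
have := @expmx_rotation R n 0 0 _ _ 0.
by rewrite scaler0 mulr0 oppr0 !scaler0 !add0r addr0; apply.
Qed.

Lemma skewmx0 (R : realType) p :
  Defs.skewmx (fun _ : upair p => 0 : R) = 0.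
Proof.
apply/matrixP => i j; rewrite !mxE.
by case: insubP => // _; case: insubP => // *; rewrite oppr0.
Qed.

(** * Derivatives of the log-likelihood at the centre of the chart *)

Section Score.
Context (R : realType) (p : nat) (lambda : 'I_p -> R) (Gamma : 'M[R]_p).
Hypotheses (lambda_gt0 : forall i, 0 < lambda i).
Hypotheses (Gamma_orth : Gamma *m Gamma^T = 1%:M).

Definition whiten : 'M[R]_p :=
  diag_mx (\row_i (Num.sqrt (lambda i))^-1) *m Gamma^T.

Definition score (k : spectral_index p) (x : p.-tuple (measurableTypeR R)) : R :=
  partial (fun th => ln (normal0_pdf (spectral_chart Gamma th) x)) (spectral_point lambda) k.

Lemma whitenE (v : 'cV[R]_p) i : (whiten *m v) i 0 = (Gamma^T *m v) i 0 / Num.sqrt (lambda i).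
Proof. by rewrite -mulmxA mul_diag_mx !mxE mulrC. Qed.

Lemma score_eigenvalue a x :
  score (inl a) x = (2 * lambda a)^-1 * ((whiten *m tuple_col x) a 0 ^+ 2 - 1).
Proof.
pose w := Gamma^T *m tuple_col x.
rewrite /score /partial derive1E whitenE -/w.
pose c : R := - ln (Num.sqrt (2 * pi)).
pose K := \sum_(i | i != a) (c - 2^-1 * (ln (lambda i) + w i 0 ^+ 2 / lambda i)) + c.
apply: (@derive_val _ _ _ _ _ _ _).
(* The explicit log-density requires positive eigenvalues, so the two functions are compared only
   for [h] near [lambda a]. *)
apply: (@near_eq_is_derive _ _ _ (fun h => K - 2^-1 * (ln h + w a 0 ^+ 2 / h))); last first.
  exact: (is_derive_eigenvalue K (w a 0) (lambda_gt0 a)).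
near=> h.
have h0 : 0 < h by near: h; exact: (lt_nbhsr (lambda_gt0 a)).
rewrite /spectral_chart.
have -> : Defs.skewmx (fun st => dfwith (spectral_point lambda) (inl a) h (inr st)) = 0.
  by rewrite -(skewmx0 R p); congr Defs.skewmx; apply/funext => st; rewrite dfwithout.
rewrite expmx0 trmx1 !mulmx1.
pose mu i : R := if i == a then h else lambda i.
have -> : \row_i dfwith (spectral_point lambda) (inl a) h (inl i) = \row_i mu i.
  apply/rowP => i; rewrite !mxE /mu; have [->|ia] := eqVneq i a; first by rewrite dfwithin.
  by rewrite dfwithout//; apply: contra_neq ia => -[].
have mu0 i : 0 < mu i by rewrite /mu; case: ifP.
rewrite ln_normal0_pdf_spectral// (bigD1 a)//= -/w -/c /mu eqxx /K.
rewrite [in RHS](eq_bigr (fun i => c - 2^-1 * (ln (lambda i) + w i 0 ^+ 2 / lambda i))).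
  by rewrite -addrA addrC.
by move=> i /negbTE ->.
Unshelve. all: by end_near. Qed.

Lemma score_angle (s t : 'I_p) (st : (s < t)%N) x :
  score (inr (mk_upair st)) x =
  Num.sqrt (lambda s) * Num.sqrt (lambda t) * ((lambda s)^-1 - (lambda t)^-1) *
  ((whiten *m tuple_col x) s 0 * (whiten *m tuple_col x) t 0).
Proof.
pose w := Gamma^T *m tuple_col x.
rewrite /score /partial derive1E !whitenE -/w.
pose c : R := - ln (Num.sqrt (2 * pi)).
pose K := \sum_(i | (i != s) && (i != t)) (c - 2^-1 * (ln (lambda i) + w i 0 ^+ 2 / lambda i)) +
  (c - 2^-1 * ln (lambda s)) + (c - 2^-1 * ln (lambda t)).
have s0 i : Num.sqrt (lambda i) != 0 by rewrite gt_eqF ?sqrtr_gt0.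
(* The square roots cancel those of the whitening, leaving the derivative in terms of the unscaled
   coordinates [w]. *)
rewrite [RHS](_ : _ = w s 0 * w t 0 * ((lambda s)^-1 - (lambda t)^-1)); last first.
  by field; rewrite !s0 !gt_eqF.
apply: (@derive_val _ _ _ _ _ _ _).
rewrite (_ : (fun h => _) = fun h => K - 2^-1 * ((cos h * w s 0 - sin h * w t 0) ^+ 2 / lambda s)
     - 2^-1 * ((cos h * w t 0 + sin h * w s 0) ^+ 2 / lambda t)).
  by apply: is_derive_rotation; rewrite gt_eqF.
apply/funext => h; rewrite /spectral_chart.
have -> : (fun u => dfwith (spectral_point lambda) (inr (mk_upair st)) h (inr u)) =
    dfwith (fun _ : upair p => 0 : R) (mk_upair st) h.
  apply/funext => u; have [->|ne] := eqVneq u (mk_upair st); first by rewrite !dfwithin.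
  by rewrite !dfwithout//; [rewrite eq_sym|apply: contra_neq ne => -[]].
rewrite skewmx_givens expmx_givens//.
have -> : \row_i dfwith (spectral_point lambda) (inr (mk_upair st)) h (inl i) = \row_i lambda i.
  by apply/rowP => i; rewrite !mxE dfwithout.
(* Moving along [u_st] keeps the eigenvalues and replaces the frame [Gamma] by the orthogonal matrix
   [Gamma *m givens s t h]; only the summands at [s] and [t] change. *)
rewrite -mulmxA -trmx_mul ln_normal0_pdf_spectral//; last first.
  by rewrite trmx_mul mulmxA -(mulmxA Gamma) givens_orthogonal// mulmx1.
rewrite trmx_mul -mulmxA -/w -/c.
have ts : t != s by rewrite neq_ltn st orbT.
rewrite (bigD1 s)//= (bigD1 t)//=.
rewrite [X in _ + (_ + X)](eq_bigr
  (fun i => c - 2^-1 * (ln (lambda i) + w i 0 ^+ 2 / lambda i))); last first.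
  by move=> i /andP[/negbTE is_ /negbTE it]; rewrite givens_trE// is_ it.
rewrite !givens_trE// !eqxx (negbTE ts) /K.
by rewrite !mulrDr; ring.
Qed.

End Score.

(** * The metric *)

Section Orthogonality.
Context (R : realType) (p : nat) (lambda : 'I_p -> R) (Gamma : 'M[R]_p).
Hypotheses (lambda_gt0 : forall i, 0 < lambda i).
Hypotheses (Gamma_orth : Gamma *m Gamma^T = 1%:M).

Definition score_deg (k : spectral_index p) (i : 'I_p) : nat :=
  match k with
  | inl a => (i == a).*2
  | inr st => (i == (val st).1) || (i == (val st).2)
  end.

Definition score_coef (k : spectral_index p) : R :=
  match k with
  | inl a => (2 * lambda a)^-1
  | inr st => let s := (val st).1 in let t := (val st).2 in
      Num.sqrt (lambda s) * Num.sqrt (lambda t) * ((lambda s)^-1 - (lambda t)^-1)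
  end.

Lemma score_hermite k x :
  score lambda Gamma k x =
  score_coef k * \prod_i hermite (score_deg k i) ((whiten lambda Gamma *m tuple_col x) i 0).
Proof.
set z := whiten _ _ *m _.
case: k => [a|[[s t] /= st]].
  rewrite score_eigenvalue// (bigD1 a)//= eqxx big1 ?mulr1//.
  by move=> i /negbTE ->.
rewrite (score_angle lambda_gt0 Gamma_orth st) -/z; congr (_ * _).
have ts : t != s by rewrite neq_ltn st orbT.
rewrite (bigD1 s)//= (bigD1 t)//= !eqxx orbT big1 ?mulr1//.
by move=> i /andP[/negbTE -> /negbTE ->].
Qed.

Lemma whiten_unit : whiten lambda Gamma \in unitmx.
Proof.
have [_ GTu] := mulmx1_unit Gamma_orth.
rewrite unitmx_mul GTu andbT unitmxE det_diag unitfE.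
by apply/prodf_neq0 => i _; rewrite mxE invr_neq0// gt_eqF ?sqrtr_gt0.
Qed.

Lemma normr_det_whiten : `|\det (whiten lambda Gamma)| = \prod_i (Num.sqrt (lambda i))^-1.
Proof.
have G1 : `|\det Gamma| = 1.
  by apply/eqP; rewrite -sqrp_eq1// -normrX det_orthogonal_sqr// normr1.
rewrite det_mulmx det_tr normrM G1 mulr1 det_diag normr_prod; apply: eq_bigr => i _.
by rewrite mxE ger0_norm// invr_ge0 sqrtr_ge0.
Qed.

(** The integrand depends on [x] only through the whitened vector, so a linear substitution turns it
    into a product over coordinates, whose factors are integrals of two Hermite polynomials. *)
Lemma spectral_metricE k l :
  spectral_metric lambda Gamma k l =
  (score_coef k * score_coef l *
   \prod_i ((score_deg l i)`!%:R * (score_deg k i == score_deg l i)%:R))%:E.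
Proof.
set W := whiten lambda Gamma.
have deg2 m i : (score_deg m i <= 2)%N.
  by case: m => [a|st] /=; [case: (i == a)|case: (_ || _)].
pose h i z := hermite (score_deg k i) z * hermite (score_deg l i) z * @normal_pdf R 0 1 z.
have [intH HE] := integrable_integral_tuple_prod
  (fun i => (integrable_integral_hermite R (deg2 k i) (deg2 l i)).1)
  (fun i => (integrable_integral_hermite R (deg2 k i) (deg2 l i)).2).
(* The density at the centre is [|\det W|] times a standard normal density in [W x]; this factor
   later cancels the Jacobian of the substitution. *)
pose c := score_coef k * score_coef l * `|\det W|.
pose F (x : p.-tuple (measurableTypeR R)) : \bar R := (c%:E * (\prod_i h i (tnth x i))%:E)%E.
have intF : (lebesgue_tuple R p).-integrable setT F by exact: integrableZl.
rewrite /spectral_metric /fisher_info.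
transitivity (\int[lebesgue_tuple R p]_x F (col_tuple (W *m tuple_col x)))%E.
  apply: eq_integral => x _; rewrite -!/(score _ _ _ _) !score_hermite /F -EFinM; congr EFin.
  have -> : normal0_pdf (spectral_chart Gamma (spectral_point lambda)) x =
      `|\det W| * \prod_i normal_pdf 0 1 ((W *m tuple_col x) i 0).
    rewrite /spectral_chart /=.
    rewrite skewmx0 expmx0 trmx1 !mulmx1 normal0_pdf_spectral// normr_det_whiten -big_split /=.
    by apply: eq_bigr => i _; rewrite whitenE.
  rewrite /c; under [in RHS]eq_bigr do rewrite tnth_mktuple.
  rewrite /h !big_split /=; ring.
rewrite (integral_linear whiten_unit)// integralZl// HE -/W -!EFinM; congr EFin.
rewrite /c [_ * `|_|]mulrC mulrA mulKf// normr_eq0.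
by have := whiten_unit; rewrite unitmxE unitfE.
Qed.

(** Distinct indices have distinct degree functions, so some coordinate pairs Hermite polynomials of
    different degrees and contributes a zero factor. *)
Lemma score_deg_orthogonal k l : k != l ->
  \prod_i ((score_deg l i)`!%:R * (score_deg k i == score_deg l i)%:R) = 0 :> R.
Proof.
move=> kl; apply/eqP; rewrite prodf_seq_eq0 /=.
apply/hasP.
suff [i ki] : exists i, score_deg k i != score_deg l i.
  by exists i; rewrite ?mem_index_enum// (negbTE ki) mulr0 eqxx.
case: k l kl => [a|[[s t] /= st]] [b|[[u v] /= uv]] kl.
- by exists a => /=; rewrite eqxx; have [ab|//] := eqVneq a b; rewrite ab eqxx in kl.
- by exists a => /=; rewrite eqxx; case: (_ || _).
- by exists b => /=; rewrite eqxx; case: (_ || _).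
(* For two angles, either [s] or [t] lies outside [{u, v}] and separates the degrees, or both lie
   inside and the orderings [s < t] and [u < v] force the pairs to coincide. *)
have [su|su] := boolP ((s == u) || (s == v)); last first.
  by exists s; rewrite /= eqxx (negbTE su).
have [tu|tu] := boolP ((t == u) || (t == v)); last first.
  by exists t; rewrite /= eqxx orbT (negbTE tu).
case/negP: kl; apply/eqP; congr inr; apply: val_inj => /=.
case/orP: su => /eqP su; case/orP: tu => /eqP tu; subst.
- by move: st; rewrite ltnn.
- by [].
- by move: st; rewrite ltnNge ltnW.
- by move: st; rewrite ltnn.
Qed.

End Orthogonality.

Unset Implicit Arguments.

Theorem proposition1 (R : realType) (p : nat)
    (lambda : 'I_p -> R) (Gamma : 'M[R]_p)
    (lambda_decr : forall i j : 'I_p, (i < j)%N -> lambda j < lambda i)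
    (lambda_gt0 : forall i : 'I_p, 0 < lambda i)
    (Gamma_orth : Gamma *m Gamma^T = 1%:M) :
  let g := spectral_metric lambda Gamma in
  [/\ forall a b : 'I_p,
        g (inl a) (inl b) = (2^-1 * (lambda a) ^- 2 * (a == b)%:R)%:E,
      forall (a s t : 'I_p) (hst : (s < t)%N),
        g (inl a) (inr (mk_upair hst)) = 0%:E
    & forall (s t u v : 'I_p) (hst : (s < t)%N) (huv : (u < v)%N),
        g (inr (mk_upair hst)) (inr (mk_upair huv)) =
        ((lambda s - lambda t) ^+ 2 * (lambda s)^-1 * (lambda t)^-1 *
         ((s, t) == (u, v))%:R)%:E].
Proof.
split=> [a b|a s t hst|s t u v hst huv]; rewrite spectral_metricE//.
- have [<-|ab] := eqVneq a b; last first.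
    by rewrite score_deg_orthogonal ?mulr0//; apply: contra_neq ab => -[].
  (* The only nontrivial factor is [2! = 2] at [a], against the squared coefficient
     [(2 * lambda a) ^- 2]. *)
  rewrite (bigD1 a)//= !eqxx big1 => [|i /negbTE ->]; last by rewrite fact0 mulr1.
  by congr EFin; rewrite /= !factS fact0; field; rewrite gt_eqF.
- by rewrite score_deg_orthogonal ?mulr0.
- have [/eqP|ne] := eqVneq (s, t) (u, v); last first.
    by rewrite score_deg_orthogonal ?mulr0//; apply: contra_neq ne => -[-> ->].
  rewrite xpair_eqE => /andP[/eqP su /eqP tv]; subst u v.
  (* All degrees are 0 or 1, so every factorial is 1 and the entry is the squared coefficient
     alone. *)
  rewrite big1 => [|i _]; last by rewrite /= eqxx; case: (_ || _); rewrite mulr1.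
  congr EFin; rewrite /= !mulr1.
  rewrite -expr2 exprMn exprMn !sqr_sqrtr ?ltW//.
  by field; rewrite !gt_eqF.
Qed.
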